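(* (i) For every constant $C > e^2$, $g(r^{(\log C)/2}, r^{r/(2C)}) \le r$ for all sufficiently large $r$. (ii) For every constant $\varepsilon>0$, $g(2^{\varepsilon \log^2 r}, 2^{r^{1-\varepsilon}}) \le r$ for all sufficiently large $r$. (iii) There exists a positive constant $c$ such that $g(cr^2, r^{r^2/2}/e^{r^2}) \le r$ for all sufficiently large $r$.
   Context: All logarithms are base 2; non-integer arguments are understood to be rounded to integers (the paper omits floor and ceiling signs). For positive integers $m,n$, the grid graph $\Gamma_{m,n}$ is the graph on vertex set $[m]\times[n]$ in which distinct vertices $(i,j),(i',j')$ are adjacent iff $i=i'$ or $j=j'$. A rectangle is the induced subgraph on $\{(i,j),(i',j),(i,j'),(i',j')\}$ with $i<i'$, $j<j'$; in an edge coloring it is alternating if $\{(i,j),(i',j)\}$ and $\{(i,j'),(i',j')\}$ have the same color and $\{(i,j),(i,j')\}$ and $\{(i',j),(i',j')\}$ have the same color. $g(m,n)$ is the minimum integer $r$ for which there exists an edge coloring of $\Gamma_{m,n}$ with $r$ colors containing no alternating rectangle. *)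

(* Defs.v *)
From Stdlib Require Import Reals.
From mathcomp Require Import all_boot.
Set Implicit Arguments. Unset Strict Implicit. Unset Printing Implicit Defensive.

Definition vtx (m n : nat) := ('I_m * 'I_n)%type.

(* An edge colouring with r colours.  Edges are unordered pairs; we encode a
   colouring as a function on ordered pairs of vertices, of which only the
   values on edges listed in canonical order (smaller coordinate first) are
   ever used.  Every colouring of the (unordered) edges arises this way. *)
Definition colouring (m n r : nat) := {ffun vtx m n * vtx m n -> 'I_r}.

Definition alt_rect m n r (col : colouring m n r) (i i' : 'I_m) (j j' : 'I_n) : bool :=
  [&& (i < i')%N, (j < j')%N,
      col ((i, j), (i', j)) == col ((i, j'), (i', j')) &
      col ((i, j), (i, j')) == col ((i', j), (i', j'))].

Definition no_alt_rect m n r (col : colouring m n r) : bool :=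
  [forall i : 'I_m, forall i' : 'I_m, forall j : 'I_n, forall j' : 'I_n,
     ~~ alt_rect col i i' j j'].

Definition good_r (m n : nat) : pred nat :=
  fun r => [exists col : colouring m n r, no_alt_rect col].

Lemma good_r_exists m n : exists r, good_r m n r.
Proof.
exists #|{: vtx m n * vtx m n}|.
apply/existsP; exists [ffun p => enum_rank p].
apply/forallP=> i; apply/forallP=> i'; apply/forallP=> j; apply/forallP=> j'.
rewrite /alt_rect !ffunE; apply/negP=> /and4P [_ ltjj /eqP E _].
move/enum_rank_inj: E => [] _ Ejj.
by move: ltjj; rewrite Ejj ltnn.
Qed.

Definition g (m n : nat) : nat := ex_minn (good_r_exists m n).

(* Rounding convention: a real argument x is rounded down, floor(x)
   (negative values are sent to 0; irrelevant for large r). *)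
Definition flr (x : R) : nat := Z.to_nat (Int_part x).

Definition log2 (x : R) : R := Rdiv (ln x) (ln 2).

(* Main.v *)
(* Colouring column j by f_j and each row suitably, an alternating rectangle
   on columns j, j' is avoided as soon as the graph of pairs on which f_j and
   f_j' agree is r-colourable. So g(m,n) <= r follows from n edge colourings
   of K_m whose pairwise agreement graphs are r-colourable, and these are
   produced greedily (Gilbert-Varshamov) once a random colouring is bad for a
   fixed one with probability at most 1/n.

   For (i) and (ii) the vertices are the leaves of a binary tree whose
   internal nodes carry independent random colours; an edge gets the colour of
   the lowest common ancestor of its ends. At a node the chromatic numbers of
   the agreement graphs of the two subtrees are added with probability 1/r
   (agreement) and otherwise replaced by their maximum. Over about log r
   levels the chromatic number behaves as if it were merely doubled: if P(X >=
   v) is about r^(1-v) at the bottom of such a block, then the same holds for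
   X/2 (rounded up) at its top. After K blocks, P(X > r) is about r^(-r/2^K).

   For (iii) the edges of K_m are coloured uniformly at random; an agreement
   graph that is not r-colourable contains a set in which all degrees are at
   least r, and a Chernoff bound together with a union bound over all sets
   makes this unlikely. *)
Require Import Defs.
From Stdlib Require Import ZArith Reals Lra.
From mathcomp Require Import all_boot zify.
Set Implicit Arguments. Unset Strict Implicit. Unset Printing Implicit Defensive.

(** * Reduction to edge colourings of a complete graph, and greedy selection *)

Definition colourable (V : finType) (r : nat) (e : rel V) : bool :=
  [exists f : {ffun V -> 'I_r}, forall x, forall y, e x y ==> (f x != f y)].

Lemma g_le_of_colourable m n r (c : 'I_n -> 'I_m -> 'I_m -> 'I_r) :
  (forall j j' : 'I_n, j < j' ->
     colourable r [rel x y : 'I_m | (x < y) && (c j x y == c j' x y)]) ->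
  g m n <= r.
Proof.
move=> Hc.
pose proper (j j' : 'I_n) (f : {ffun 'I_m -> 'I_r}) :=
  [forall x : 'I_m, forall y : 'I_m,
     ((x < y) && (c j x y == c j' x y)) ==> (f x != f y)].
(* For [p.1.2 < p.2.2] the hypothesis makes [pick] succeed, so the horizontal edge in row x gets
   colour f x; the last branch only makes the function total. *)
pose col : colouring m n r := [ffun p =>
  if p.1.2 == p.2.2 then c p.1.2 p.1.1 p.2.1
  else if [pick f | proper p.1.2 p.2.2 f] is Some f then f p.1.1
  else c p.1.2 p.1.1 p.2.1].
suff good : good_r m n r by rewrite /g; case: ex_minnP => k _; apply.
apply/existsP; exists col.
apply/forallP=> x; apply/forallP=> y; apply/forallP=> j; apply/forallP=> j'.
apply/negP=> /and4P [ltxy ltj]; rewrite !ffunE /= !eqxx (ltn_eqF ltj : (j == j') = false).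
case: pickP => [f Hf|Hno] eqc; last first.
  by case/existsP: (Hc _ _ ltj) => f Hf; move: (Hno f); rewrite /proper Hf.
by move/forallP/(_ x)/forallP/(_ y): Hf; rewrite ltxy eqc /= => /negbTE ->.
Qed.

(** Constant colourings with distinct colours have edgeless agreement graphs. *)
Lemma g_le_of_few_columns m n r : n <= r -> g m n <= r.
Proof.
move=> lenr.
apply: (@g_le_of_colourable _ _ _ (fun j _ _ => widen_ord lenr j)) => j j' ltj.
have r_gt0 : 0 < r by apply: leq_trans lenr; apply: leq_ltn_trans (ltn_ord j).
apply/existsP; exists [ffun _ => Ordinal r_gt0].
apply/forallP=> x; apply/forallP=> y; rewrite /= -(inj_eq val_inj) /=.
by rewrite (ltn_eqF ltj) andbF.
Qed.

(** Fewer than [n] chosen elements spoil less than all of [S], so another choice is always possible.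
    New elements are put at the head of the list, so smaller indices are later choices; hence the
    order in [bad (f j') (f j)]. *)
Lemma gilbert_varshamov (S : finType) (bad : rel S) n :
  0 < #|S| -> (forall s, n * #|[pred t | bad s t]| <= #|S|) ->
  exists f : 'I_n -> S, forall j j' : 'I_n, j < j' -> ~~ bad (f j') (f j).
Proof.
move=> S_gt0 Hbad.
have [l szl Hl] : exists2 l : seq S, size l = n
    & pairwise (fun t s => ~~ bad s t) l.
  suff: forall k, k <= n -> exists2 l : seq S, size l = k
    & pairwise (fun t s => ~~ bad s t) l by apply.
  elim=> [|k IHk] lekn; first by exists [::].
  have [l szl Hl] := IHk (ltnW lekn).
  case: (boolP [exists t, all (fun s => ~~ bad s t) l]) => [/existsP [t Ht]|/existsPn Hall].
    by exists (t :: l); rewrite /= ?szl // Ht.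
  have cover : #|S| <= \sum_(s <- l) #|[pred t | bad s t]|.
    under eq_bigr => s _ do rewrite -sum1_card big_mkcond /=.
    rewrite exchange_big /= -sum1_card; apply: leq_sum => t _.
    have /allPn [s sl /negbNE bst] := Hall t.
    by rewrite (big_rem s) //= inE /= bst leq_addr.
  exfalso; have : n * #|S| <= k * #|S|.
    apply: leq_trans (leq_mul (leqnn n) cover) _.
    rewrite big_distrr /= -szl -sum1_size big_distrl /=.
    by apply: leq_sum => s _; rewrite mul1n.
  by rewrite leq_pmul2r // leqNgt lekn.
case: n szl Hbad => [|n] szl Hbad; first by have [s0 _] := card_gt0P S_gt0; exists (fun=> s0); case.
case: l szl Hl => [//|s0 l] szl /(pairwiseP s0) Hl.
by exists (fun j => nth s0 (s0 :: l) j) => j j' ltj; apply: Hl => //; rewrite inE szl.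
Qed.

(** * Binary tree colourings and their agreement graphs *)

(** A nested product rather than a function on nodes, so that sums over colourings split at the
    root. *)
Fixpoint node_colouring (r h : nat) : finType :=
  if h is h'.+1 then ('I_r * (node_colouring r h' * node_colouring r h'))%type
  else unit.

Fixpoint leaf (h : nat) : finType :=
  if h is h'.+1 then (bool * leaf h')%type else unit.

Lemma card_leaf h : #|leaf h| = 2 ^ h.
Proof. by elim: h => [|h IHh]; rewrite ?card_unit // card_prod card_bool IHh expnS. Qed.

Lemma card_node_colouringS r h :
  #|node_colouring r h.+1| = r * (#|node_colouring r h| * #|node_colouring r h|).
Proof. by rewrite !card_prod card_ord. Qed.

Lemma card_node_colouring_gt0 r h : 0 < r -> 0 < #|node_colouring r h|.
Proof.
move=> r0; elim: h => [|h IHh]; first by rewrite card_unit.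
by rewrite card_node_colouringS !muln_gt0 r0 IHh.
Qed.

(** The default [d] is reached only when the two leaves coincide. *)
Fixpoint tree_colour (r : nat) (d : 'I_r) (h : nat) :
    node_colouring r h -> leaf h -> leaf h -> 'I_r :=
  match h with
  | 0 => fun _ _ _ => d
  | h'.+1 => fun c x y =>
      if x.1 == y.1 then
        tree_colour d (if x.1 then c.2.1 else c.2.2) x.2 y.2
      else c.1
  end.

(* One less than a colour count sufficient for the agreement graph of the two
   colourings. *)
Fixpoint excess (r h : nat) : node_colouring r h -> node_colouring r h -> nat :=
  match h with
  | 0 => fun _ _ => 0
  | h'.+1 => fun c c' =>
      let u := excess c.2.1 c'.2.1 in let v := excess c.2.2 c'.2.2 in
      if c.1 == c'.1 then (u + v).+1 else maxn u v
  end.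

(** If the roots agree, every pair across the two subtrees is an agreement, so the right palette is
    shifted past the left one. Otherwise no agreement crosses and the palettes may overlap. *)
Lemma excess_colouring r (d : 'I_r) h (c c' : node_colouring r h) :
  exists2 f : leaf h -> nat, forall x, f x <= excess c c' &
    forall x y, x != y -> tree_colour d c x y = tree_colour d c' x y -> f x != f y.
Proof.
elim: h c c' => [|h IHh] /=; first by move=> *; exists (fun=> 0) => // -[] [].
case=> a [c1 c2] [a' [c1' c2']] /=.
have [f1 le1 f1P] := IHh c1 c1'; have [f2 le2 f2P] := IHh c2 c2'.
have [_|neqa] := eqVneq a a'.
- exists (fun x => if x.1 then f1 x.2 else (excess c1 c1').+1 + f2 x.2).
    case=> [[] x] /=; last by rewrite addSn ltnS leq_add2l.
    by apply: leq_trans (le1 x) _; rewrite -addnS leq_addr.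
  case=> b x [b' y] /=; have [<-{b'}|neqb] := eqVneq b b'.
    rewrite xpair_eqE eqxx /=; case: b => neqxy; first exact: f1P.
    by rewrite eqn_add2l; apply: f2P.
  move=> _ _; case: b b' neqb => [] [] //= _.
    by rewrite neq_ltn addSn ltnS (leq_trans (le1 x)) ?leq_addr.
  by rewrite neq_ltn addSn ltnS (leq_trans (le1 y)) ?leq_addr ?orbT.
- exists (fun x => if x.1 then f1 x.2 else f2 x.2).
    by case=> [[] x] /=; rewrite leq_max ?le1 ?le2 ?orbT.
  case=> b x [b' y] /=; have [<-{b'}|neqb] := eqVneq b b'; last first.
    by move=> _ eqa; rewrite eqa eqxx in neqa.
  by rewrite xpair_eqE eqxx /=; case: b => neqxy; [apply: f1P | apply: f2P].
Qed.

(** * Parity weights and one level of the recursion *)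

(* With D = 2^k and Z = y + 1 where y = excess %/ D, r^floor((Z-1)/2) and
   r^floor(Z/2) measure the odd and even tails of Z separately: merging two
   subtrees adds parities, so the two expectations obey a closed recursion,
   which a single moment would not do without losing a constant factor in each
   block. *)
Definition wt_odd (r y : nat) : nat := r ^ (y./2).
Definition wt_even (r y : nat) : nat := if y is 0 then 0 else r ^ (uphalf y).

Lemma wt_odd_gt0 r y : 0 < r -> 0 < wt_odd r y.
Proof. by move=> r0; rewrite expn_gt0 r0. Qed.

Lemma leq_wt_odd r x y : 0 < r -> x <= y -> wt_odd r x <= wt_odd r y.
Proof. by move=> r0 lexy; rewrite leq_pexp2l // half_leq. Qed.

Lemma leq_wt_even r x y : 0 < r -> x <= y -> wt_even r x <= wt_even r y.
Proof.
by case: x y => [|x] [|y] // r0 lexy; rewrite leq_pexp2l // uphalf_leq.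
Qed.

(** In terms of Z the join is addition. If Z_x is even the exponents of the first product add up
    exactly, otherwise those of the second; [maxn 1] covers x = y = 0, where both products
    vanish. *)
Lemma wt_odd_join r x y : 0 < r ->
  wt_odd r (x + y).+1 <=
  maxn 1 (wt_even r x * wt_odd r y + wt_odd r x * wt_even r y).
Proof.
move=> r0.
have E z : z./2 + uphalf z = z by rewrite uphalf_half addnCA addnn odd_double_half.
rewrite leq_max /wt_odd /wt_even; case: x => [|x].
  case: y => [|y]; first by [].
  by rewrite mul0n !add0n mul1n leqnn orbT.
case: y => [|y]; first by rewrite addn0 muln1 leq_addr orbT.
apply/orP; right.
rewrite -!expnD; case: (boolP (odd x.+1)) => ox.
  apply: leq_trans (leq_addr _ _); rewrite leq_pexp2l //.
  by move: ox; lia.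
apply: leq_trans (leq_addl _ _); rewrite leq_pexp2l //.
by move: ox; lia.
Qed.

(** When Z_x and Z_y are both odd, rounding each half down loses one unit, which the factor [r]
    repays. *)
Lemma wt_even_join r x y : 0 < r ->
  wt_even r (x + y).+1 <= r * (wt_odd r x * wt_odd r y) + wt_even r x * wt_even r y.
Proof.
move=> r0; rewrite /wt_odd /wt_even.
case: (boolP (odd x || odd y)) => [oxy|].
  case: x oxy => [|x] oxy.
    by apply: leq_trans (leq_addr _ _); rewrite mul1n -expnS leq_pexp2l.
  case: y oxy => [|y] oxy.
    apply: leq_trans (leq_addr _ _); rewrite muln1 -expnS leq_pexp2l //.
    by move: oxy; lia.
  apply: leq_trans (leq_addl _ _); rewrite -expnD leq_pexp2l //.
  by move: oxy; lia.
rewrite negb_or => /andP [ox oy].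
apply: leq_trans (leq_addr _ _); rewrite -expnD -expnS leq_pexp2l //.
by move: ox oy; lia.
Qed.

(** Excess measured in units of [D] obeys the same merging rule as excess itself, so every block can
    run the same recursion. *)
Lemma divn_join D u v : 0 < D -> (u + v).+1 %/ D <= (u %/ D + v %/ D).+1.
Proof.
move=> D0; rewrite -ltnS ltn_divLR //.
by have := ltn_ceil u D0; have := ltn_ceil v D0; nia.
Qed.

Lemma leq_maxn_sum (w : nat -> nat) u v c :
  (forall x, c <= w x) -> w (maxn u v) + c <= w u + w v.
Proof.
move=> Hc; case: (leqP u v) => _; last by rewrite leq_add2l.
by rewrite addnC leq_add2r.
Qed.

(** [A] is the cost charged for every root colour, [B] the extra cost of agreement, which occurs for
    one root colour out of [r]. *)
Lemma sum_node_le (T1 T2 : finType) r (a0 : 'I_r)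
    (F : 'I_r * (T1 * T2) -> nat) (A B : T1 -> T2 -> nat) :
  (forall a x y, F (a, (x, y)) <= A x y + (a == a0) * B x y) ->
  \sum_c F c <= r * (\sum_x \sum_y A x y) + \sum_x \sum_y B x y.
Proof.
move=> HF.
have -> : \sum_c F c = \sum_a \sum_x \sum_y F (a, (x, y)).
  rewrite (eq_bigr (fun c => F (c.1, (c.2.1, c.2.2)))); last by case=> a [].
  rewrite -(pair_bigA _ (fun a p => F (a, (p.1, p.2)))) /=; apply: eq_bigr => a _.
  by rewrite -(pair_bigA _ (fun x y => F (a, (x, y)))).
have -> : r * (\sum_x \sum_y A x y) = \sum_(a < r) \sum_x \sum_y A x y.
  by rewrite sum_nat_const card_ord.
have -> : \sum_x \sum_y B x y = \sum_(a < r) (a == a0) * \sum_x \sum_y B x y.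
  rewrite (bigD1 a0) //= eqxx mul1n [X in _ + X]big1 ?addn0 // => a /negbTE ->.
  by rewrite mul0n.
rewrite -big_split; apply: leq_sum => a _ /=.
rewrite big_distrr -big_split; apply: leq_sum => x _ /=.
by rewrite big_distrr -big_split; apply: leq_sum => y _ /=.
Qed.

Definition odd_sum r h D (c0 : node_colouring r h) : nat :=
  \sum_(c : node_colouring r h) wt_odd r (excess c c0 %/ D).
Definition even_sum r h D (c0 : node_colouring r h) : nat :=
  \sum_(c : node_colouring r h) wt_even r (excess c c0 %/ D).

(** The summand added on the left is the baseline: [wt_odd] is at least 1, so the weight of a
    maximum plus 1 is at most the sum of the two weights. This lets the deviation from 1, not the
    mean itself, double per level. *)
Lemma sum_wt_odd_step r h D (a0 : 'I_r) (x0 y0 : node_colouring r h) : 0 < D ->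
  @odd_sum r h.+1 D (a0, (x0, y0)) + r * (#|node_colouring r h| * #|node_colouring r h|) <=
  r * (odd_sum D x0 * #|node_colouring r h| + #|node_colouring r h| * odd_sum D y0)
  + (even_sum D x0 * odd_sum D y0 + odd_sum D x0 * even_sum D y0).
Proof.
move=> D0; set T := node_colouring r h.
have r0 : 0 < r by apply: leq_ltn_trans (ltn_ord a0).
pose o (z0 z : T) := wt_odd r (excess z z0 %/ D).
pose e (z0 z : T) := wt_even r (excess z z0 %/ D).
have -> : r * (#|T| * #|T|) = \sum_(c : node_colouring r h.+1) 1.
  by rewrite sum1_card card_node_colouringS.
rewrite -big_split.
apply: leq_trans (@sum_node_le T T r a0 _ (fun x y => o x0 x + o y0 y)
   (fun x y => e x0 x * o y0 y + o x0 x * e y0 y) _) _.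
  move=> a x y /=; case: eqP => _ /=; rewrite ?mul1n ?mul0n ?addn0; last first.
    rewrite /o; set u := excess x x0; set v := excess y y0.
    apply: (@leq_maxn_sum (fun u => wt_odd r (u %/ D))) => // z.
    exact: wt_odd_gt0.
  apply: leq_trans (leq_add (leq_wt_odd r0 (divn_join _ _ D0)) (leqnn 1)) _.
  apply: leq_trans (leq_add (wt_odd_join _ _ r0) (leqnn 1)) _.
  have := wt_odd_gt0 (excess x x0 %/ D) r0; have := wt_odd_gt0 (excess y y0 %/ D) r0.
  by rewrite -/(o x0 x) -/(o y0 y) -/(e x0 x) -/(e y0 y); lia.
apply: eq_leq; congr (_ * _ + _).
  under eq_bigr => x _ do rewrite big_split /= sum_nat_const.
  by rewrite big_split /= sum_nat_const -big_distrr /= mulnC.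
under eq_bigr => x _ do rewrite big_split /= -!big_distrr /=.
by rewrite big_split /= -!big_distrl.
Qed.

Lemma sum_wt_even_step r h D (a0 : 'I_r) (x0 y0 : node_colouring r h) : 0 < D ->
  @even_sum r h.+1 D (a0, (x0, y0)) <=
  r * (even_sum D x0 * #|node_colouring r h| + #|node_colouring r h| * even_sum D y0)
  + (r * (odd_sum D x0 * odd_sum D y0) + even_sum D x0 * even_sum D y0).
Proof.
move=> D0; set T := node_colouring r h.
have r0 : 0 < r by apply: leq_ltn_trans (ltn_ord a0).
pose o (z0 z : T) := wt_odd r (excess z z0 %/ D).
pose e (z0 z : T) := wt_even r (excess z z0 %/ D).
apply: leq_trans (@sum_node_le T T r a0 _ (fun x y => e x0 x + e y0 y)
   (fun x y => r * (o x0 x * o y0 y) + e x0 x * e y0 y) _) _.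
  move=> a x y /=; case: eqP => _ /=; rewrite ?mul1n ?mul0n ?addn0; last first.
    rewrite /e; set u := excess x x0; set v := excess y y0.
    by case: (leqP u v) => _; rewrite ?leq_addr ?leq_addl.
  apply: leq_trans (leq_wt_even r0 (divn_join _ _ D0)) _.
  apply: leq_trans (wt_even_join _ _ r0) _.
  by rewrite leq_addl.
apply: eq_leq; congr (_ * _ + _).
  under eq_bigr => x _ do rewrite big_split /= sum_nat_const.
  by rewrite big_split /= sum_nat_const -big_distrr /= mulnC.
under eq_bigr => x _ do rewrite big_split /= -!big_distrr /=.
rewrite big_split /= -!big_distrl -big_distrr /=; congr (_ + _).
by rewrite -big_distrl.
Qed.


(** * The recursion over one block of levels, in real numbers *)

Lemma INR_addn m n : INR (m + n) = Rplus (INR m) (INR n).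
Proof. by rewrite -plusE plus_INR. Qed.

Lemma INR_muln m n : INR (m * n) = Rmult (INR m) (INR n).
Proof. by rewrite -multE mult_INR. Qed.

Lemma INR_expn m n : INR (m ^ n) = pow (INR m) n.
Proof. by elim: n => // n IHn; rewrite expnS INR_muln IHn. Qed.

Lemma leq_INR m n : reflect (Rle (INR m) (INR n)) (m <= n).
Proof.
by apply: (iffP idP) => [/leP /le_INR //|H]; apply/leP; apply: INR_le.
Qed.

Lemma INR_gt0 n : 0 < n -> Rlt 0 (INR n).
Proof. by move/ltP => /lt_0_INR. Qed.

Open Scope R_scope.

Lemma INR_exp2 j : INR (2 ^ j) = 2 ^ j.
Proof. by rewrite INR_expn. Qed.

(** Normalised so that [o] and [e] are both of order 1/r at the start of a block: the odd mean is at
    most 1 + o, the even mean at most r e. *)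
Definition block_bound (r h D : nat) (o e : R) : Prop :=
  forall c0 : node_colouring r h,
    INR (odd_sum D c0) <= (1 + o) * INR #|node_colouring r h| /\
    INR (even_sum D c0) <= INR r * e * INR #|node_colouring r h|.

Lemma block_bound_weaken r h D o e o' e' :
  o <= o' -> e <= e' -> block_bound r h D o e -> block_bound r h D o' e'.
Proof.
move=> leo lee Hb c0; have [Ho He] := Hb c0.
have N0 := pos_INR #|node_colouring r h|; have r0 := pos_INR r.
split; first by apply: Rle_trans Ho _; apply: Rmult_le_compat_r => //; lra.
by apply: Rle_trans He _; apply: Rmult_le_compat_r => //; apply: Rmult_le_compat_l.
Qed.

(** This is the pair of one-level sum inequalities divided by r N^2, where N counts the colourings
    of a subtree. *)
Lemma block_bound_step r h D o e : (0 < D)%N -> (0 < r)%N ->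
  block_bound r h D o e ->
  block_bound r h.+1 D (2 * o + 2 * e * (1 + o))
    (2 * e + e ^ 2 + (1 + o) ^ 2 / INR r).
Proof.
move=> D0 r0 Hb [a0 [x0 y0]].
have rpos := INR_gt0 r0.
rewrite card_node_colouringS !INR_muln.
have [ox ex] := Hb x0; have [oy ey] := Hb y0.
have := pos_INR (odd_sum D x0); have := pos_INR (odd_sum D y0).
have := pos_INR (even_sum D x0); have := pos_INR (even_sum D y0).
have /leq_INR := sum_wt_odd_step a0 x0 y0 D0.
have /leq_INR := sum_wt_even_step a0 x0 y0 D0.
rewrite !(INR_addn, INR_muln).
move: ox ex oy ey; have := pos_INR #|node_colouring r h|.
set N := INR #|_|; set Ox := INR _; set Ex := INR (even_sum _ _).
set Oy := INR (odd_sum _ _); set Ey := INR (even_sum D y0).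
set O' := INR (odd_sum _ _); set E' := INR (even_sum _ _).
set q := INR r in rpos *.
move=> N0 ox ex oy ey HE HO Ey0 Ex0 Oy0 Ox0.
have p1 := Rmult_le_compat _ _ _ _ Ex0 Oy0 ex oy.
have p2 := Rmult_le_compat _ _ _ _ Ox0 Ey0 ox ey.
have p3 := Rmult_le_compat _ _ _ _ Ox0 Oy0 ox oy.
have p4 := Rmult_le_compat _ _ _ _ Ex0 Ey0 ex ey.
have qN : 0 <= q * N by apply: Rmult_le_pos => //; lra.
have q1 := Rmult_le_compat_l _ _ _ qN ox.
have q2 := Rmult_le_compat_l _ _ _ qN oy.
have q3 := Rmult_le_compat_l _ _ _ qN ex.
have q4 := Rmult_le_compat_l _ _ _ qN ey.
have q5 := Rmult_le_compat_l _ _ _ (Rlt_le _ _ rpos) p3.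
split; first by lra.
have -> : q * (2 * e + e ^ 2 + (1 + o) ^ 2 / q) * (q * (N * N)) =
  q * (2 * e + e ^ 2) * (q * (N * N)) + (1 + o) ^ 2 * (q * (N * N)).
  by field; lra.
by lra.
Qed.

Definition pow_sum r h D (c0 : node_colouring r h) : nat :=
  (\sum_(c : node_colouring r h) r ^ (excess c c0 %/ D))%N.

(** This hands one block over to the next: an odd-weight bound in units of [D] is a plain moment
    bound in units of 2 D. *)
Lemma odd_sum_pow_sum r h D (c0 : node_colouring r h) :
  odd_sum D c0 = pow_sum (D * 2) c0.
Proof. by apply: eq_bigr => c _; rewrite /wt_odd -divn2 divnMA. Qed.

(** For the even weight, uphalf y <= y. For the odd one, r * r^(y./2) is r when y <= 1 and at most
    r^y when y >= 2. *)
Lemma block_bound_start r h D : (0 < r)%N ->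
  (forall c0 : node_colouring r h, (pow_sum D c0 <= 2 * #|node_colouring r h|)%N) ->
  block_bound r h D (2 / INR r) (2 / INR r).
Proof.
move=> r0 Hp c0; have rpos := INR_gt0 r0.
have even_le : (even_sum D c0 <= pow_sum D c0)%N.
  apply: leq_sum => c _; rewrite /wt_even; case: (_ %/ _)%N => [|y] //.
  by rewrite leq_pexp2l //; lia.
have odd_le : (r * odd_sum D c0 <= r * #|node_colouring r h| + pow_sum D c0)%N.
  rewrite -sum1_card !big_distrr -big_split; apply: leq_sum => c _ /=.
  rewrite /wt_odd; case: (_ %/ _)%N => [|[|y]] /=; rewrite ?leq_addr //.
  by apply: leq_trans (leq_addl _ _); rewrite -expnS leq_pexp2l //; lia.
have /leq_INR := Hp c0; move: even_le odd_le => /leq_INR He /leq_INR.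
rewrite !(INR_addn, INR_muln) /= => Ho Hpow.
split; last by replace (INR r * (2 / INR r)) with 2 by (field; lra); lra.
apply: (Rmult_le_reg_l (INR r)) => //.
set N := INR #|_| in Ho Hpow *.
replace (INR r * ((1 + 2 / INR r) * N)) with (INR r * N + 2 * N) by (field; lra).
by lra.
Qed.

(* With F = e + 4/q the recursion for e gives 1 + F' <= (1 + F)^2, which x /
   (1 - x) with x doubling at each step majorises. *)
Lemma block_recursion (J P q : R) : 0 <= J -> 1 <= P ->
  2 * P * (24 * (J + 1) + 12) <= q ->
  let x := 6 * P / q in let o := P * (2 + 24 * J) / q in
  let e := x / (1 - x) - 4 / q in
  2 * o + 2 * e * (1 + o) <= 2 * P * (2 + 24 * (J + 1)) / q /\
  2 * e + e ^ 2 + (1 + o) ^ 2 / q <= 2 * x / (1 - 2 * x) - 4 / q.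
Proof.
move=> J0 P1 Hq.
have q0 : 0 < q by nra.
have : / q * q = 1 by apply: Rinv_l; lra.
have : 0 < / q by apply: Rinv_0_lt_compat.
rewrite /Rdiv; set i := / q => i0 iq.
set x := 6 * P * i; set o := P * (2 + 24 * J) * i.
have Pi : 0 < P * i by apply: Rmult_lt_0_compat; lra.
have iP : i <= P * i by nra.
have Hqi : 48 * (J * (P * i)) + 72 * (P * i) <= 1.
  by have := Rmult_le_compat_r i _ _ (Rlt_le _ _ i0) Hq; rewrite (Rmult_comm q) iq; lra.
have JPi : 0 <= J * (P * i) by apply: Rmult_le_pos; lra.
have xE : x = 6 * (P * i) by rewrite /x; ring.
have oE : o = 2 * (P * i) + 24 * (J * (P * i)) by rewrite /o; ring.
have x1 : x <= 1 / 12 by lra.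
have HF : x * / (1 - x) * (1 - x) = x by field; lra.
set F := x * / (1 - x) in HF *.
have F1 : x <= F by nra.
have F2 : F <= 2 * x by nra.
split.
  replace (2 * P * (2 + 24 * (J + 1)) * i) with (2 * o + 8 * x) by (rewrite /o /x; ring).
  nra.
(* Since 1 + F = 1 / (1 - x), this amounts to 1 - 2x <= (1 - x)^2. *)
have key : 2 * F + F ^ 2 <= 2 * x * / (1 - 2 * x).
  have -> : 2 * F + F ^ 2 = (2 * x - x ^ 2) / (1 - x) ^ 2 by rewrite /F; field; lra.
  apply: (Rmult_le_reg_r ((1 - x) ^ 2)); first by nra.
  rewrite {1}/Rdiv Rmult_assoc Rinv_l; last by nra.
  apply: (Rmult_le_reg_r (1 - 2 * x)); first by lra.
  replace (2 * x * / (1 - 2 * x) * (1 - x) ^ 2 * (1 - 2 * x))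
    with (2 * x * (1 - x) ^ 2) by (field; lra).
  nra.
(* Doubling turns the shift -4/q into -8/q; this term uses up at most 4/q of it, which restores
   -4/q. *)
have : (1 + o) ^ 2 <= 4 by nra.
nra.
Qed.

(** Both errors roughly double per level; [o] also receives about 2e each time, whence the extra
    factor linear in [j]. *)
Lemma block_bound_iter r h D j : (0 < D)%N -> (2 ^ j * (24 * j + 12) <= r)%N ->
  block_bound r h D (2 / INR r) (2 / INR r) ->
  let y := 6 * 2 ^ j / INR r in
  block_bound r (h + j) D (2 ^ j * (2 + 24 * INR j) / INR r) (y / (1 - y) - 4 / INR r).
Proof.
move=> D0 + Hb; elim: j => [|j IHj] Hj y.
  have r12 : 12 <= INR r by move/leq_INR: Hj; rewrite INR_IZR_INZ.
  have y0 : 0 < y by rewrite /y /=; apply: Rdiv_lt_0_compat; lra.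
  have y1 : y <= 1 / 2.
    by rewrite /y /=; apply: (Rmult_le_reg_r (INR r)); [lra | field_simplify; lra].
  rewrite addn0; apply: block_bound_weaken Hb; first by apply: Req_le; rewrite /=; field; lra.
  have -> : 2 / INR r = y - 4 / INR r by rewrite /y /=; field; lra.
  apply: Rplus_le_compat_r; apply: (Rmult_le_reg_r (1 - y)); first by lra.
  by rewrite /Rdiv Rmult_assoc Rinv_l; nra.
have r0 : (0 < r)%N by apply: leq_trans Hj; rewrite muln_gt0 expn_gt0 /= addn_gt0 orbT.
have rpos := INR_gt0 r0.
have Hj' : (2 ^ j * (24 * j + 12) <= r)%N.
  apply: leq_trans Hj; apply: leq_mul; first by rewrite leq_pexp2l.
  by rewrite leq_add2r leq_mul2l leqnSn.
have r' : 2 * 2 ^ j * (24 * (INR j + 1) + 12) <= INR r.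
  by move/leq_INR: Hj; rewrite !(INR_muln, INR_addn, INR_exp2) (S_INR j) /=; lra.
have [Ho He] := block_recursion (pos_INR j) (pow_R1_Rle 2 j ltac:(lra)) r'.
rewrite addnS; apply: block_bound_weaken (block_bound_step D0 r0 (IHj Hj')).
  by rewrite S_INR; apply: Rle_trans Ho _; apply: Req_le.
apply: Rle_trans He _; apply: Req_le; rewrite /y /=.
by replace (6 * (2 * 2 ^ j) / INR r) with (2 * (6 * 2 ^ j / INR r)) by (rewrite /Rdiv; ring).
Qed.

(** Induction on blocks: a mean of at most 2 starts a block, and the condition on [h] keeps [o] at
    most 1 at its end, so the mean in doubled units is again at most 2. *)
Lemma pow_sum_le r h K (c0 : node_colouring r (h * K)) :
  (2 ^ h * (24 * h + 12) <= r)%N ->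
  (pow_sum (2 ^ K) c0 <= 2 * #|node_colouring r (h * K)|)%N.
Proof.
move=> Hh.
have r0 : (0 < r)%N.
  by apply: leq_trans Hh; rewrite muln_gt0 expn_gt0 addn_gt0 /= orbT.
have rpos := INR_gt0 r0.
elim: K c0 => [|K IHK].
  rewrite muln0 => c0; rewrite /pow_sum card_unit muln1.
  by rewrite (eq_bigr (fun=> 1%N)) ?sum1_card ?card_unit // => -[].
rewrite mulnSr => c0.
have Hb := block_bound_iter (expn_gt0 2 K) Hh (block_bound_start r0 IHK).
have [Ho _] := Hb c0; rewrite expnSr -odd_sum_pow_sum.
apply/leq_INR; rewrite INR_muln; apply: Rle_trans Ho _.
apply: Rmult_le_compat_r; first exact: pos_INR.
have : 2 ^ h * (2 + 24 * INR h) / INR r <= 1; last by rewrite /=; lra.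
apply: (Rmult_le_reg_r (INR r)) => //.
move/leq_INR: Hh; rewrite !(INR_muln, INR_addn, INR_exp2) /= => Hh.
have P0 : 0 < 2 ^ h by apply: pow_lt; lra.
by field_simplify; [nra | lra].
Qed.

Close Scope R_scope.

(** By Markov's inequality, excess at least [r] has probability at most 2 / r^(r %/ 2^K), hence at
    most 1/n. *)
Lemma g_le_tree m n r h K :
  2 ^ h * (24 * h + 12) <= r -> m <= 2 ^ (h * K) -> 2 * n <= r ^ (r %/ 2 ^ K) ->
  g m n <= r.
Proof.
move=> Hh lem len.
have r0 : 0 < r by apply: leq_trans Hh; rewrite muln_gt0 expn_gt0 addn_gt0 /= orbT.
set H := (h * K) in lem.
pose T := node_colouring r H.
have Hbad (s : T) : n * #|[pred t : T | r <= excess t s]| <= #|T|.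
  have le1 : r ^ (r %/ 2 ^ K) * #|[pred t : T | r <= excess t s]| <= pow_sum (2 ^ K) s.
    rewrite -sum1_card big_distrr /= big_mkcond /=; apply: leq_sum => t _.
    by rewrite inE; case: ifP => // le; rewrite muln1 leq_pexp2l // leq_div2r.
  have := leq_trans le1 (pow_sum_le s Hh); rewrite -/T.
  have := leq_mul len (leqnn #|[pred t : T | r <= excess t s]|).
  by set b := #|_|; set N := #|_|; nia.
have [f Hf] := gilbert_varshamov (card_node_colouring_gt0 H r0) Hbad.
have lemc : m <= #|leaf H| by rewrite card_leaf.
pose v (i : 'I_m) : leaf H := enum_val (widen_ord lemc i).
apply: (@g_le_of_colourable _ _ _
  (fun j x y => tree_colour (Ordinal r0) (f j) (v x) (v y))) => j j' ltj.
have [c lec cP] := excess_colouring (Ordinal r0) (f j) (f j').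
have exlt : excess (f j) (f j') < r by rewrite ltnNge; apply: Hf.
apply/existsP; exists [ffun i => Ordinal (leq_ltn_trans (lec (v i)) exlt)].
apply/forallP=> x; apply/forallP=> y; apply/implyP=> /= /andP [ltxy /eqP eqc].
rewrite !ffunE -(inj_eq val_inj) /=; apply: cP => //.
apply/eqP=> /enum_val_inj /(congr1 val) /= eqxy.
by rewrite eqxy ltnn in ltxy.
Qed.

(** * Uniformly random colourings: dense cores, Chernoff and union bounds *)

Definition neighbours (V : finType) (e : rel V) (A : {set V}) (x : V) : {set V} :=
  [set y in A | e x y || e y x].

(** Without such a set, each nonempty vertex set has a vertex with fewer than [r] neighbours in it:
    remove it, colour the rest, and give it a free colour. *)
Lemma dense_core (V : finType) (e : rel V) r : 0 < r -> irreflexive e ->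
  ~~ colourable r e ->
  exists2 A : {set V}, A != set0 & forall x, x \in A -> r <= #|neighbours e A x|.
Proof.
move=> r0 irr /existsP not_col.
case: (boolP [exists A : {set V}, (A != set0) &&
    [forall x in A, r <= #|neighbours e A x|]]).
  by case/existsP=> A /andP [A0 /forall_inP HA]; exists A.
move=> /existsPn no_core; case: not_col.
suff [f Hf] : exists f : V -> 'I_r, forall x y, x \in setT -> y \in setT ->
    e x y -> f x != f y.
  exists [ffun x => f x]; apply/forallP=> x; apply/forallP=> y.
  by apply/implyP=> exy; rewrite !ffunE; apply: Hf.
move: [set: V] => A; have [k] := ubnP #|A|; elim: k A => // k IHk A.
have [-> _|A0 leA] := eqVneq A set0.
  by exists (fun=> Ordinal r0) => x y; rewrite inE.
have /forall_inPn [x xA lt_nb] : ~~ [forall x in A, r <= #|neighbours e A x|].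
  by have := no_core A; rewrite A0.
have [f Hf] := IHk (A :\ x) ltac:(by rewrite (cardsD1 x A) xA in leA).
have /existsP [c Hc] : [exists c, c \notin [set f y | y in neighbours e A x]].
  apply: contraR lt_nb => /existsPn all_in.
  apply: leq_trans (leq_imset_card f _).
  rewrite -[leqLHS]card_ord -cardsT; apply/subset_leq_card/subsetP => c _.
  by have := all_in c; rewrite negbK.
exists (fun y => if y == x then c else f y) => y z yA zA eyz.
have fresh w : w \in A -> e x w || e w x -> c != f w.
  move=> wA xw; apply: contraNneq Hc => ->; apply: imset_f.
  by rewrite inE wA.
have [eyx|neyx] := eqVneq y x; have [ezx|nezx] := eqVneq z x.
- by rewrite eyx ezx irr in eyz.
- by apply: fresh => //; rewrite -eyx eyz.
- by rewrite eq_sym; apply: fresh => //; rewrite -ezx eyz orbT.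
- by apply: Hf => //; rewrite !inE ?neyx ?nezx.
Qed.

Section RandomColouring.
Variables m r : nat.
Let S := {ffun 'I_m * 'I_m -> 'I_r}.

Definition agree (s t : S) : rel 'I_m :=
  [rel x y : 'I_m | (x < y) && (s (x, y) == t (x, y))].

Definition inner_pairs (A : {set 'I_m}) : {set 'I_m * 'I_m} :=
  [set p | [&& p.1 \in A, p.2 \in A & p.1 < p.2]].

Definition agreements (s t : S) (A : {set 'I_m}) : nat :=
  \sum_(p in inner_pairs A) (s p == t p).

(** The pairs and their mirror images are disjoint subsets of A x A. *)
Lemma card_inner_pairs (A : {set 'I_m}) : 2 * #|inner_pairs A| <= #|A| ^ 2.
Proof.
pose P' := [set (p.2, p.1) | p in inner_pairs A].
have cP' : #|P'| = #|inner_pairs A|.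
  by apply: card_imset => -[a b] [a' b'] /= [-> ->].
have dis : [disjoint inner_pairs A & P'].
  rewrite -setI_eq0; apply/eqP/setP => -[a b]; rewrite !inE /=.
  apply/negP=> /andP [/and3P [_ _ ltab] /imsetP [[a' b']]].
  rewrite inE /= => /and3P [_ _ ltab'] [ea eb].
  by move: ltab ltab'; rewrite ea eb; case: ltngtP.
rewrite mul2n -addnn -{2}cP' -cardsUI (disjoint_setI0 dis) cards0 addn0.
rewrite expnS expn1 -cardsX; apply/subset_leq_card/subsetP => -[a b].
rewrite !inE /= => /orP [/and3P [-> ->] //|/imsetP [[a' b']]].
by rewrite inE /= => /and3P [aA bA _] [-> ->]; rewrite aA bA.
Qed.

(** Handshake: summing degrees over [A] counts each agreement twice. *)
Lemma agreements_core s t (A : {set 'I_m}) :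
  (forall x, x \in A -> r <= #|neighbours (agree s t) A x|) ->
  r * #|A| <= 2 * agreements s t A.
Proof.
move=> HA.
have -> : agreements s t A = \sum_(x in A) \sum_(y in A) agree s t x y.
  rewrite pair_big_dep /= /agreements [LHS]big_mkcond [RHS]big_mkcond /=.
  apply: eq_bigr => -[x y] _ /=; rewrite inE /=.
  by rewrite /agree /=; case: (x \in A) => //=; case: (y \in A) => //=; case: (x < y).
rewrite mul2n -addnn {2}exchange_big -big_split /= mulnC -sum_nat_const.
apply: leq_sum => x xA; apply: leq_trans (HA x xA) _.
rewrite -big_split -sum1_card big_mkcond [leqRHS]big_mkcond /=.
apply: leq_sum => y _; rewrite inE; case: (y \in A) => //=.
by move: (agree s t x y) (agree s t y x) => [] [].
Qed.

(** The exponential moment factors over pairs: a pair inside [A] contributes r - 1 + lam, any other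
    pair r. Cross-multiplying avoids division. *)
Lemma sum_exp_agreements (lam : nat) s (A : {set 'I_m}) :
  (\sum_(t : S) lam ^ agreements s t A) * r ^ #|inner_pairs A| <=
  (r + lam) ^ #|inner_pairs A| * #|{: S}|.
Proof.
pose w p (c : 'I_r) := if p \in inner_pairs A then lam ^ (s p == c) else 1.
have -> : \sum_(t : S) lam ^ agreements s t A = \prod_p \sum_c w p c.
  rewrite bigA_distr_bigA /=; apply: eq_bigr => t _.
  rewrite /agreements big_mkcond /= expn_sum; apply: eq_bigr => p _.
  by rewrite /w; case: ifP.
have wE p : \sum_c w p c <= if p \in inner_pairs A then r + lam else r.
  rewrite /w; case: ifP => _; last by rewrite sum1_card card_ord.
  rewrite (bigD1 (s p)) //= eqxx expn1 addnC leq_add2r.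
  rewrite (eq_bigr (fun=> 1)) => [|c /negbTE]; last by rewrite eq_sym => ->.
  by rewrite sum1_card -[leqRHS]card_ord max_card.
apply: leq_trans (leq_mul (leq_prod (fun p _ => wE p)) (leqnn _)) _.
rewrite card_ffun card_ord card_prod card_ord.
have -> : r ^ (m * m) = \prod_(p : 'I_m * 'I_m) r.
  by rewrite prod_nat_const card_prod card_ord.
rewrite [X in _ * X <= _](_ : _ = \prod_(p in inner_pairs A) r); last first.
  by rewrite prod_nat_const.
rewrite (bigID (mem (inner_pairs A)) predT (fun=> r)) /=.
rewrite (bigID (mem (inner_pairs A)) predT) /=.
rewrite (eq_bigr (fun=> r + lam)) => [|p ->] //.
rewrite [X in _ * X * _ <= _](eq_bigr (fun=> r)) => [|p /negbTE ->] //.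
by rewrite prod_nat_const mulnAC mulnA.
Qed.

End RandomColouring.

(** Markov's inequality for lam^agreements, with threshold half of r |A| rounded up. *)
Lemma card_agreements_core m r n (lam : nat -> nat) (s : {ffun 'I_m * 'I_m -> 'I_r})
    (A : {set 'I_m}) : 0 < r -> 0 < lam #|A| ->
  n * (r + lam #|A|) ^ #|inner_pairs A| <=
    lam #|A| ^ uphalf (r * #|A|) * r ^ #|inner_pairs A| ->
  n * #|[pred t | r * #|A| <= 2 * agreements s t A]| <=
    #|{: {ffun 'I_m * 'I_m -> 'I_r}}|.
Proof.
move=> r0 l0 Hn; set b := #|[pred t | _]|; pose S := {ffun 'I_m * 'I_m -> 'I_r}.
set l := lam _ in l0 Hn; set E := #|inner_pairs A| in Hn.
set L := uphalf _ in Hn.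
have markov : b * l ^ L <= \sum_(t : S) l ^ agreements s t A.
  rewrite -[b]sum1_card big_distrl big_mkcond /=; apply: leq_sum => t _.
  rewrite inE; case: ifP => // le; rewrite mul1n leq_pexp2l //.
  by rewrite /L; move: le; move: (r * _) (agreements _ _ _) => a a'; lia.
have pos : 0 < l ^ L * r ^ E by rewrite muln_gt0 !expn_gt0 l0 r0.
rewrite -(leq_pmul2r pos).
apply: leq_trans (_ : n * ((r + l) ^ E * #|{: S}|) <= _).
  rewrite -mulnA leq_mul2l mulnA.
  by rewrite (leq_trans (leq_mul markov (leqnn _)) (sum_exp_agreements _ _ _)) orbT.
by rewrite mulnA mulnC leq_mul2l Hn orbT.
Qed.

(** Union bound by size: each of the m + 1 possible sizes contributes at most [N]. *)
Lemma sum_sets_le m (x : {set 'I_m} -> nat) (P : pred {set 'I_m}) N :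
  (forall A, P A -> 'C(m, #|A|) * x A <= N) -> \sum_(A | P A) x A <= m.+1 * N.
Proof.
move=> Hx.
have lem (A : {set 'I_m}) : #|A| < m.+1 by rewrite ltnS -[leqRHS]card_ord max_card.
rewrite (partition_big (fun A => Ordinal (lem A)) predT) //=.
have -> : m.+1 * N = \sum_(k < m.+1) N by rewrite sum_nat_const card_ord.
apply: leq_sum => k _.
have C0 : 0 < 'C(m, k) by rewrite bin_gt0 -ltnS.
rewrite -(leq_pmul2l C0) big_distrr /=.
apply: leq_trans (_ : \sum_(A : {set 'I_m} | #|A| == k) N <= _); last first.
  have := card_draws ('I_m) k; rewrite card_ord => <-.
  rewrite sum_nat_const leq_mul2r; apply/orP; right.
  by apply/subset_leq_card/subsetP => A; rewrite !inE.
rewrite big_mkcond [leqRHS]big_mkcond /=; apply: leq_sum => A _.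
case: andP => // -[PA /eqP <-] /=; rewrite eqxx; exact: Hx.
Qed.

Lemma g_le_random m n r (lam : nat -> nat) : 0 < r -> (forall k, 0 < lam k) ->
  (forall k E, r < k <= m -> 2 * E <= k ^ 2 ->
     n * (m.+1 * 'C(m, k)) * (r + lam k) ^ E <= lam k ^ uphalf (r * k) * r ^ E) ->
  g m n <= r.
Proof.
move=> r0 l0 Hlam.
pose S := {ffun 'I_m * 'I_m -> 'I_r}.
pose bad (s t : S) := ~~ colourable r (agree s t).
have Hbad s : n * #|[pred t | bad s t]| <= #|{: S}|.
  rewrite -(leq_pmul2l (ltn0Sn m)).
  pose core (A : {set 'I_m}) : pred S := [pred t | r * #|A| <= 2 * agreements s t A].
  apply: leq_trans (_ : \sum_(A : {set 'I_m} | r < #|A|) n * m.+1 * #|core A| <= _).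
    rewrite -big_distrr /= mulnA (mulnC m.+1) leq_mul2l; apply/orP; right.
    under eq_bigr => A _ do rewrite -sum1_card big_mkcond /=.
    rewrite exchange_big -sum1_card big_mkcond /=; apply: leq_sum => t _.
    rewrite inE; case: ifP => // /(dense_core r0) [|A A0 HA].
      by move=> x; rewrite /agree /= ltnn.
    have [x xA] := set0Pn _ A0.
    (* No vertex is its own neighbour, so a core has more than [r] elements. *)
    have ltA : r < #|A|.
      apply: leq_ltn_trans (HA x xA) _; apply: proper_card.
      apply/properP; split; first by apply/subsetP=> y; rewrite inE => /andP [].
      by exists x; rewrite // inE /agree /= ltnn andbF.
    by rewrite (bigD1 A) //= inE (agreements_core HA).
  apply: sum_sets_le => A ltA.
  rewrite mulnA (mulnC 'C(_, _)) -(mulnA n).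
  apply: (@card_agreements_core _ _ _ lam) => //.
  apply: Hlam; last exact: card_inner_pairs.
  by rewrite ltA -[leqRHS]card_ord max_card.
have S0 : 0 < #|{: S}| by apply/card_gt0P; exists [ffun=> Ordinal r0].
have [f Hf] := gilbert_varshamov S0 Hbad.
apply: (@g_le_of_colourable _ _ _ (fun j x y => f j (x, y))) => j j' ltj.
have /negbNE /existsP [c /forallP Hc] := Hf _ _ ltj.
apply/existsP; exists c; apply/forallP=> x; apply/forallP=> y.
by have := forallP (Hc x) y; rewrite /agree /= (eq_sym (f j (x, y))).
Qed.

Open Scope R_scope.

(** * Rounding, logarithms and the choice of block height *)

Lemma INR_flr_le x : 0 <= x -> INR (flr x) <= x.
Proof.
move=> x0; have [Hx Hx'] := base_Int_part x.
have : (-1 < Int_part x)%Z by apply: lt_IZR; lra.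
by rewrite /flr INR_IZR_INZ => Hz; rewrite Z2Nat.id; [lra | lia].
Qed.

Lemma flr_leq x N : x <= INR N -> (flr x <= N)%N.
Proof.
move=> xN; have [x0|x0] := Rle_lt_dec 0 x.
  by apply/leq_INR; apply: Rle_trans (INR_flr_le x0) xN.
rewrite /flr; have [Hx _] := base_Int_part x.
have : (Int_part x < 0)%Z by apply: lt_IZR; lra.
by case: (Int_part x).
Qed.

Lemma exp_le x y : x <= y -> exp x <= exp y.
Proof. by case=> [/exp_increasing|->]; lra. Qed.

Lemma ln_le x y : 0 < x -> x <= y -> ln x <= ln y.
Proof. by move=> x0 [/(ln_increasing _ _ x0)|->]; lra. Qed.

Lemma ln_gt0_inv x : 0 < ln x -> 0 < x.
Proof. by rewrite /ln; case: Rlt_dec => // _ /Rlt_irrefl. Qed.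

Lemma exists_nat_above z : 0 <= z -> exists K : nat, z < INR K <= z + 1.
Proof.
move=> z0; have [Hu Hu'] := archimed z.
exists (Z.to_nat (up z)); rewrite INR_IZR_INZ Z2Nat.id; first by lra.
by apply: le_IZR; lra.
Qed.

Lemma ln_eventually_ge (a : R) : exists r0 : nat, forall r : nat, (r0 <= r)%N ->
  a <= ln (INR r).
Proof.
have [K [HK _]] := exists_nat_above (Rlt_le _ _ (exp_pos a)).
exists K => r /leq_INR Kr; rewrite -[X in X <= _](ln_exp a).
by apply: ln_le; [apply: exp_pos | lra].
Qed.

Lemma ln_le_sub1 t : 0 < t -> ln t <= t - 1.
Proof. by move=> t0; have := exp_ineq1_le (ln t); rewrite exp_ln //; lra. Qed.

Lemma ln_scaled_le_linear (b eta : R) : 0 < b -> 0 < eta ->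
  exists a, forall l, a <= l -> ln (b * l) <= eta * l.
Proof.
move=> b0 eta0; exists (4 * b / eta ^ 2 + 1) => l Hl.
have e2 : 0 < eta ^ 2 by apply: pow_lt.
have l1 : 1 <= l.
  by have : 0 < 4 * b / eta ^ 2; [apply: Rdiv_lt_0_compat | ]; lra.
have bl : 0 < b * l by apply: Rmult_lt_0_compat; lra.
have s0 := sqrt_lt_R0 _ bl.
have ss : sqrt (b * l) * sqrt (b * l) = b * l by apply: sqrt_sqrt; lra.
rewrite -{1}ss ln_mult //; have := ln_le_sub1 s0.
have : sqrt (b * l) <= eta * l / 2.
  apply: Rsqr_incr_0_var; last by nra.
  rewrite /Rsqr ss.
  have : 4 * b <= eta ^ 2 * l.
    replace (4 * b) with (eta ^ 2 * (4 * b / eta ^ 2)) by (field; lra).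
    by apply: Rmult_le_compat_l; lra.
  by nra.
by lra.
Qed.

Lemma ln2_bounds : 1 / 2 < ln 2 < 1.
Proof.
have := ln_increasing 2 (exp 1); have := exp_ineq1 1; rewrite ln_exp.
by have := ln_lt_2; lra.
Qed.

(* The constant 200 absorbs 2^(h+1) * (24 * (h + 1) + 12) with h <= 2 ln r,
   for the largest admissible h. *)
Lemma exists_height (r : nat) : 4 <= ln (INR r) -> exists h : nat,
  (2 ^ h * (24 * h + 12) <= r)%N /\
  ln (INR r) - ln (200 * ln (INR r)) <= INR h * ln 2.
Proof.
move=> Hl; set l := ln (INR r) in Hl *.
have r0 : 0 < INR r by apply: ln_gt0_inv; rewrite -/l; lra.
have rE : INR r = exp l by rewrite exp_ln.
pose P h := (2 ^ h * (24 * h + 12) <= r)%N.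
have P0 : P 0%N.
  rewrite /P; apply/leq_INR; rewrite rE.
  have e1 := exp_ineq1_le 1.
  have : exp 4 <= exp l by apply: exp_le.
  have -> : exp 4 = exp 1 * exp 1 * (exp 1 * exp 1) by rewrite -!exp_plus; congr exp; lra.
  have : 4 <= exp 1 * exp 1 by nra.
  by rewrite !(INR_muln, INR_addn, INR_exp2) /=; nra.
have Pmax h : P h -> (h <= r)%N.
  by move=> Ph; apply: leq_trans Ph; rewrite mulnDr; have := ltn_expl h (isT : (1 < 2)%N); nia.
have [h Ph hmax] := ex_maxnP (ex_intro P _ P0) Pmax.
exists h; split => //.
have /negP : ~~ P h.+1 by apply/negP => /hmax; rewrite ltnn.
rewrite /P => /negP; rewrite -ltnNge => /ltnW /leq_INR.
rewrite !(INR_muln, INR_addn, INR_exp2) (S_INR h) rE => Hlt.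
have l2 := ln2_bounds.
have P2 : 0 < 2 ^ h by apply: pow_lt; lra.
have h0 := pos_INR h.
have hl : INR h * ln 2 <= l.
  rewrite -ln_pow; last lra.
  rewrite -(ln_exp l) -rE; apply: ln_le => //.
  by rewrite -INR_exp2; apply/leq_INR; apply: leq_trans Ph; rewrite leq_pmulr // addn_gt0 orbT.
have : exp l <= 2 ^ h * (200 * l).
  apply: Rle_trans Hlt _; rewrite [2 ^ _.+1]/=.
  have : INR h <= 2 * l by nra.
  have -> : INR 24 = 24 by rewrite /=; lra.
  have -> : INR 12 = 12 by rewrite /=; lra.
  nra.
move/(ln_le (exp_pos _)); rewrite ln_exp ln_mult //; last lra.
by rewrite ln_pow; lra.
Qed.

(** The tree bound in logarithmic form: ln (200 l) is the loss in block height, and -1 comes from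
    rounding r / 2^K down. *)
Lemma g_le_tree_exp (r K : nat) (x y : R) :
  let l := ln (INR r) in
  4 <= l -> x <= INR K * (l - ln (200 * l)) ->
  ln 2 + y <= l * (INR r / 2 ^ K - 1) ->
  (g (flr (exp x)) (flr (exp y)) <= r)%N.
Proof.
move=> l Hl Hx Hy; have [h [Hh Hhl]] := exists_height Hl.
have r0 : 0 < INR r by apply: ln_gt0_inv; rewrite -/l; lra.
have P2 : 0 < 2 ^ K by apply: pow_lt; lra.
have l2 := ln2_bounds.
apply: (g_le_tree (h := h) (K := K)) => //.
  apply: flr_leq; rewrite INR_exp2 -Rpower_pow; last by lra.
  rewrite /Rpower INR_muln; set b := _ * _ * ln 2.
  apply: exp_le; apply: Rle_trans Hx _; have -> : b = INR K * (INR h * ln 2) by rewrite /b; ring.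
  by apply: Rmult_le_compat_l Hhl; apply: pos_INR.
apply/leq_INR; rewrite INR_muln INR_expn.
apply: Rle_trans (_ : 2 * exp y <= _).
  by apply: Rmult_le_compat_l; [rewrite /=; lra | apply/INR_flr_le/Rlt_le/exp_pos].
rewrite -Rpower_pow // /Rpower -{1}(exp_ln 2); last by lra.
rewrite -exp_plus.
apply: exp_le; apply: Rle_trans Hy _; rewrite Rmult_comm; apply: Rmult_le_compat_r; first by lra.
have : INR r <= 2 ^ K * (INR (r %/ 2 ^ K) + 1).
  rewrite -INR_exp2 -S_INR -INR_muln mulnC; apply/leq_INR/ltnW.
  by apply: ltn_ceil; rewrite expn_gt0.
move=> H; apply: (Rmult_le_reg_l (2 ^ K)) => //.
replace (2 ^ K * (INR r / 2 ^ K - 1)) with (INR r - 2 ^ K) by (field; lra).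
by lra.
Qed.


(** * Parameter choices for the tree bound *)

Lemma pow2_le_exp K z : INR K <= z + 1 -> 2 ^ K <= 2 * exp (z * ln 2).
Proof.
move=> Kz; rewrite -Rpower_pow; last by lra.
rewrite /Rpower -{2}(exp_ln 2); last by lra.
rewrite -exp_plus; apply: exp_le; have := ln2_bounds.
by have : INR K * ln 2 <= (z + 1) * ln 2; [apply: Rmult_le_compat_r; have := ln2_bounds; lra | lra].
Qed.

(** The number of blocks [K] is constant with 2^K <= 2 sqrt C. As [K] strictly exceeds [gam], the
    slack (K - gam) l absorbs the logarithmic loss in height. *)
Lemma g_le_polynomial (C : R) : exp 2 < C ->
  exists r0 : nat, forall r : nat, (r0 <= r)%N ->
    (g (flr (Rpower (INR r) (log2 C / 2)))
       (flr (Rpower (INR r) (INR r / (2 * C)))) <= r)%N.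
Proof.
move=> HC; have l2 := ln2_bounds.
have C0 : 0 < C by have := exp_pos 2; lra.
have lC : 2 < ln C by rewrite -(ln_exp 2); apply: ln_increasing => //; apply: exp_pos.
set gam := log2 C / 2.
have gamE : gam * ln 2 = ln C / 2 by rewrite /gam /log2; field; lra.
have gam0 : 0 <= gam by nra.
have [K [gamK Kgam]] := exists_nat_above gam0.
set s := exp (ln C / 2).
have sC : s * s = C by rewrite -exp_plus -{3}(exp_ln C) //; congr exp; lra.
have s2 : 2 <= s by have := exp_ineq1_le (ln C / 2); rewrite -/s; lra.
have K2 : 2 ^ K <= 2 * s by have := pow2_le_exp Kgam; rewrite gamE.
have P2 : 0 < 2 ^ K by apply: pow_lt; lra.
have K1 : 0 < INR K by lra.
have [a Ha] := @ln_scaled_le_linear 200 ((INR K - gam) / INR K) ltac:(lra)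
  ltac:(apply: Rdiv_lt_0_compat; lra).
have [b [Hb _]] := exists_nat_above (Rmult_le_pos 8 s ltac:(lra) ltac:(lra)).
have [r0 Hr0] := ln_eventually_ge (Rmax a 4).
exists (maxn r0 b) => r; rewrite geq_max => /andP [/Hr0 Hl /leq_INR Hr].
have la := Rle_trans _ _ _ (Rmax_l a 4) Hl.
have l4 := Rle_trans _ _ _ (Rmax_r a 4) Hl.
have {}Ha := Ha _ la; set l := ln (INR r) in Ha Hl la l4.
apply: (@g_le_tree_exp r K) => //; rewrite -/l.
  have : INR K * ln (200 * l) <= (INR K - gam) * l.
    replace ((INR K - gam) * l) with (INR K * ((INR K - gam) / INR K * l)) by (field; lra).
    by apply: Rmult_le_compat_l; lra.
  by lra.
have lower : INR r / (2 * s) <= INR r / 2 ^ K.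
  by apply: Rmult_le_compat_l; [lra | apply: Rinv_le_contravar].
(* Of the summand 2, one unit pays for rounding and the other for ln 2. It is available because s =
   sqrt C >= 2 and r > 8 s. *)
have upper : INR r / (2 * C) + 2 <= INR r / (2 * s).
  rewrite -sC; apply: (Rmult_le_reg_r (2 * (s * s))); first by nra.
  replace ((INR r / (2 * (s * s)) + 2) * (2 * (s * s))) with (INR r + 4 * (s * s)) by (field; lra).
  replace (INR r / (2 * s) * (2 * (s * s))) with (INR r * s) by (field; lra).
  by nra.
by nra.
Qed.

Lemma g_le_quasipolynomial (eps : R) : 0 < eps ->
  exists r0 : nat, forall r : nat, (r0 <= r)%N ->
    (g (flr (Rpower 2 (eps * (log2 (INR r)) ^ 2)))
       (flr (Rpower 2 (Rpower (INR r) (1 - eps)))) <= r)%N.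
Proof.
move=> e0; have l2 := ln2_bounds.
have [e1|e1] := Rle_lt_dec 1 eps.
  (* For eps >= 1 there are at most two columns. *)
  exists 2%N => r r2; apply: g_le_of_few_columns; apply: (leq_trans _ r2).
  have l0 : 0 <= ln (INR r).
    by rewrite -ln_1; apply: ln_le; [lra | have /leq_INR := ltnW r2].
  apply: flr_leq; rewrite {1}/Rpower -[X in _ <= X](exp_ln 2) /=; last by lra.
  apply: exp_le; have : Rpower (INR r) (1 - eps) <= 1.
    by rewrite -[X in _ <= X]exp_0; apply: exp_le; nra.
  by nra.
(* Below, 2^K is at most 2 r^eps (200 l)^bet. Here 1 - bet = (1 - eps)^2 > 0, so the factor l = ln r
   gained from the base of r^(r / 2^K) outweighs (200 l)^bet. *)
set eta := 1 - eps; set bet := eps * (1 + eta).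
have eta0 : 0 < eta by rewrite /eta; lra.
have bet1 : 0 < 1 - bet by rewrite /bet /eta; nra.
have [a1 Ha1] := @ln_scaled_le_linear 200 (eta / (1 + eta)) ltac:(lra)
  ltac:(apply: Rdiv_lt_0_compat; lra).
have [a2 Ha2] := @ln_scaled_le_linear 200 eta ltac:(lra) eta0.
(* Chosen so that l >= a3 gives 6 (200 l)^bet <= l. *)
set a3 := exp (ln 1200 / (1 - bet)).
have [r0 Hr0] := ln_eventually_ge (Rmax (Rmax a1 a2) (Rmax a3 4)).
exists r0 => r /Hr0; set l := ln (INR r) => Hl.
have [Hl12 Hl34] := (Rle_trans _ _ _ (Rmax_l _ _) Hl, Rle_trans _ _ _ (Rmax_r _ _) Hl).
have {}Ha1 := Ha1 _ (Rle_trans _ _ _ (Rmax_l _ _) Hl12).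
have {}Ha2 := Ha2 _ (Rle_trans _ _ _ (Rmax_r _ _) Hl12).
have la3 := Rle_trans _ _ _ (Rmax_l _ _) Hl34.
have l4 := Rle_trans _ _ _ (Rmax_r _ _) Hl34.
have rE : INR r = exp l by rewrite exp_ln //; apply: ln_gt0_inv; rewrite -/l; lra.
have expD : exp (ln (200 * l)) = 200 * l by rewrite exp_ln; lra.
have HD : ln 1200 <= (1 - bet) * ln (200 * l).
  have -> : ln 1200 = (1 - bet) * ln a3 by rewrite /a3 ln_exp; field; lra.
  apply: Rmult_le_compat_l; first by lra.
  by apply: ln_le; [apply: exp_pos | lra].
set D := ln (200 * l) in Ha1 Ha2 expD HD.
have D0 : 0 <= D by rewrite /D -ln_1; apply: ln_le; lra.
have Hd : l <= (1 + eta) * (l - D).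
  have : (1 + eta) * D <= eta * l; last by lra.
  replace (eta * l) with ((1 + eta) * (eta / (1 + eta) * l)) by (field; lra).
  by apply: Rmult_le_compat_l; lra.
have d0 : 0 < l - D by nra.
set z := eps * l ^ 2 / (ln 2 * (l - D)).
have z0 : 0 <= z.
  by apply: Rmult_le_pos; [nra | apply/Rlt_le/Rinv_0_lt_compat; nra].
have [K [zK Kz]] := exists_nat_above z0.
have zE : z * ln 2 <= eps * l + bet * D.
  apply: (Rmult_le_reg_r (l - D)) => //.
  replace (z * ln 2 * (l - D)) with (eps * (l * (l - D)) + eps * (l * D))
    by (rewrite /z; field; lra).
  have : eps * (l * D) <= eps * ((1 + eta) * (l - D) * D); last by rewrite /bet; lra.
  by apply: Rmult_le_compat_l; [lra | apply: Rmult_le_compat_r].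
have P2 : 0 < 2 ^ K by apply: pow_lt; lra.
have Pup : 2 ^ K <= 2 * exp (eps * l + bet * D).
  apply: Rle_trans (pow2_le_exp Kz) _.
  by apply: Rmult_le_compat_l; [lra | apply: exp_le].
have Rl : 200 * l <= exp (eta * l) by rewrite -expD; apply: exp_le.
rewrite /Rpower -/l -/eta; apply: (@g_le_tree_exp r K) => //; rewrite -/l -/D.
  have -> : eps * log2 (INR r) ^ 2 * ln 2 = z * (l - D).
    by rewrite /log2 -/l /z; field; lra.
  by apply: Rmult_le_compat_r; lra.
have : 3 * exp (eta * l) <= l * (INR r / 2 ^ K); last by nra.
apply: (Rmult_le_reg_r (2 ^ K)) => //.
replace (l * (INR r / 2 ^ K) * 2 ^ K) with (l * INR r) by (field; lra).
apply: Rle_trans (_ : 3 * exp (eta * l) * (2 * exp (eps * l + bet * D)) <= _).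
  by apply: Rmult_le_compat_l Pup; have := exp_pos (eta * l); lra.
have -> : 3 * exp (eta * l) * (2 * exp (eps * l + bet * D)) =
    6 * (exp l * exp (bet * D)).
  have -> : exp l = exp (eta * l) * exp (eps * l).
    by rewrite -exp_plus; congr exp; rewrite /eta; ring.
  by rewrite exp_plus; ring.
have : 1200 * exp (bet * D) <= 200 * l.
  rewrite -[X in X * _ <= _](exp_ln 1200); last by lra.
  by rewrite -exp_plus -expD; apply: exp_le; lra.
by rewrite rE; have := exp_pos l; nra.
Qed.

(** * Parameter choices for the uniformly random colouring *)

Lemma leq_bin_expn m k : ('C(m, k) <= m ^ k)%N.
Proof.
apply: leq_trans (_ : m ^_ k <= _)%N.
  by rewrite -bin_ffact leq_pmulr // fact_gt0.
elim: k m => [|k IHk] [|m] //; rewrite ffactnS expnS leq_mul2l /=.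
by apply: leq_trans (IHk m) _; case: {IHk}k => // k; rewrite leq_exp2r.
Qed.

(** The logarithm of the union bound condition, with rho = r and kap = k. Setting t = kap / rho and
    dividing by rho^2 / 2 reduces it to [main], which is tightest near t = 1; there the -2 coming
    from the factor e^(-r^2) makes room for the error terms. *)
Lemma dense_core_rate (l rho kap : R) : 4 <= l -> 0 < rho -> l = ln rho -> 80 * l <= rho ->
  rho <= kap -> kap <= rho ^ 2 / 100 ->
  rho ^ 2 / 2 * l - rho ^ 2 + 2 * l + 2 * l * kap + (rho * kap + kap ^ 2 / rho) / 2 <=
  rho * kap / 2 * (2 * l - ln kap).
Proof.
move=> l4 rho0 lE rho80 Hk1 Hk2.
have i0 : 0 < / rho by apply: Rinv_0_lt_compat.
pose t := kap / rho.
have kE : kap = rho * t by rewrite /t; field; lra.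
have t1 : 1 <= t by nra.
have t2 : t <= rho / 100 by nra.
have ln100 : 4 <= ln 100.
  rewrite -(ln_exp 4); apply: ln_le; first exact: exp_pos.
  have -> : exp 4 = exp 1 * exp 1 * (exp 1 * exp 1) by rewrite -!exp_plus; congr exp; lra.
  have := exp_ineq1_le 1; move: (exp 1) exp_le_3 => e e3 e2.
  have : 0 <= e * e <= 9 by nra.
  by nra.
have a4 : 4 <= l - ln t.
  have : ln (100 * t) <= l by rewrite lE; apply: ln_le; lra.
  by rewrite ln_mult; lra.
have lt1 := ln_le_sub1 (Rlt_le_trans 0 1 t ltac:(lra) t1).
have -> : ln kap = l + ln t by rewrite kE ln_mult -?lE; lra.
set a := l - ln t in a4.
replace (2 * l - (l + ln t)) with a by (rewrite /a; ring).
have {}lE : l = a + ln t by rewrite /a; ring.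
have tail : 2 * l + 2 * l * kap <= rho ^ 2 / 2 * (t / 10).
  have : 2 * l <= 2 * l * kap by nra.
  have : 80 * l * kap <= rho * kap by apply: Rmult_le_compat_r; lra.
  by rewrite kE; nra.
have sq : kap ^ 2 / rho <= rho ^ 2 * (t / 100).
  replace (kap ^ 2 / rho) with (rho * t * t) by (rewrite kE; field; lra).
  by nra.
have main : l - 2 + 111 / 100 * t <= t * a by nra.
have := Rmult_le_compat_l (rho ^ 2 / 2) _ _ ltac:(nra) main.
have -> : rho * kap = rho ^ 2 * t by rewrite kE; ring.
by lra.
Qed.

Lemma g_le_quadratic : exists c : R, 0 < c /\
  exists r0 : nat, forall r : nat, (r0 <= r)%N ->
    (g (flr (c * INR r ^ 2))
       (flr (Rpower (INR r) (INR r ^ 2 / 2) / exp (INR r ^ 2))) <= r)%N.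
Proof.
(* This gives k / r <= r / 100, hence ln r - ln (k / r) >= ln 100 >= 4. *)
exists (1 / 100); split; first by lra.
have [a Ha] := @ln_scaled_le_linear 80 1 ltac:(lra) ltac:(lra).
have [r0 Hr0] := ln_eventually_ge (Rmax a 4).
exists r0 => r /Hr0; set l := ln (INR r) => Hl.
have {}Ha := Ha _ (Rle_trans _ _ _ (Rmax_l _ _) Hl).
have l4 := Rle_trans _ _ _ (Rmax_r _ _) Hl.
have rpos : 0 < INR r by apply: ln_gt0_inv; rewrite -/l; lra.
have rE : INR r = exp l by rewrite exp_ln.
have r0' : (0 < r)%N by apply/ltP/INR_lt.
have r80 : 80 * l <= INR r.
  by rewrite rE -[X in X <= _]exp_ln; [apply: exp_le; lra | lra].
set m := flr _; set n := flr _.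
have Hm : INR m <= INR r ^ 2 / 100.
  by apply: Rle_trans (INR_flr_le _) _; nra.
have Hn : INR n <= exp (INR r ^ 2 / 2 * l - INR r ^ 2).
  apply: Rle_trans (INR_flr_le _) _.
    by apply: Rmult_le_pos; [apply/Rlt_le/exp_pos | apply/Rlt_le/Rinv_0_lt_compat/exp_pos].
  by rewrite /Rpower -/l /Rminus exp_plus exp_Ropp; apply: Rle_refl.
(* The Chernoff base is about r^2 / k, the ratio of the threshold r k / 2 to the expected number k^2
   / (2 r) of agreements. *)
apply: (@g_le_random _ _ _ (fun k => (r ^ 2 %/ k).+1)) => // k E /andP [ltk lekm] HE.
have k0 : (0 < k)%N by apply: leq_ltn_trans ltk.
have kpos := INR_gt0 k0.
move: ltk lekm HE => /ltnW /leq_INR Hrk /leq_INR Hkm /leq_INR.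
rewrite INR_muln INR_expn => HE.
set lam := (_ %/ k).+1.
have lam_up : INR lam <= INR r ^ 2 / INR k + 1.
  rewrite S_INR; apply: Rplus_le_compat_r; apply: (Rmult_le_reg_r (INR k)) => //.
  replace (INR r ^ 2 / INR k * INR k) with (INR r ^ 2) by (field; lra).
  by rewrite -INR_expn -INR_muln; apply/leq_INR; apply: leq_trunc_div.
have lam_low : INR r ^ 2 / INR k <= INR lam.
  apply: (Rmult_le_reg_r (INR k)) => //.
  replace (INR r ^ 2 / INR k * INR k) with (INR r ^ 2) by (field; lra).
  by rewrite -INR_expn -INR_muln; apply/leq_INR/ltnW/ltn_ceil.
have lnlam : 2 * l - ln (INR k) <= ln (INR lam).
  have -> : 2 * l - ln (INR k) = ln (INR r ^ 2 / INR k).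
    have r2 : 0 < INR r ^ 2 by apply: pow_lt.
    have ik := Rinv_0_lt_compat _ kpos.
    by rewrite /Rdiv ln_mult // ln_Rinv // ln_pow //= -/l; ring.
  by apply: ln_le => //; apply: Rdiv_lt_0_compat; nra.
have lnk : ln (INR k) <= 2 * l.
  have -> : 2 * l = ln (INR r ^ 2) by rewrite ln_pow //= -/l; ring.
  by apply: ln_le => //; nra.
apply/leq_INR; rewrite !(INR_muln, INR_expn, INR_addn).
have rateb := dense_core_rate l4 rpos erefl r80 Hrk (Rle_trans _ _ _ Hkm Hm).
have HM : INR m.+1 <= exp (2 * l).
  replace (2 * l) with (l + l) by ring.
  by rewrite exp_plus -rE S_INR; nra.
have HC : INR 'C(m, k) <= exp (2 * l * INR k).
  apply: Rle_trans (_ : INR (m ^ k) <= _); first exact/leq_INR/leq_bin_expn.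
  rewrite INR_expn; apply: Rle_trans (_ : exp (2 * l) ^ k <= _).
    by apply: pow_incr; split; [apply: pos_INR | rewrite S_INR in HM; lra].
  rewrite -Rpower_pow; last exact: exp_pos.
  by rewrite /Rpower ln_exp; apply: exp_le; lra.
(* Uses 1 + lam / r <= exp (lam / r), E <= k^2 / 2 and lam <= r^2 / k + 1. *)
have HL : (INR r + INR lam) ^ E <=
    INR r ^ E * exp ((INR r * INR k + INR k ^ 2 / INR r) / 2).
  apply: Rle_trans (_ : (INR r * exp (INR lam / INR r)) ^ E <= _).
    apply: pow_incr; split; first by have := pos_INR lam; lra.
    have := Rmult_le_compat_l _ _ _ (Rlt_le _ _ rpos) (exp_ineq1_le (INR lam / INR r)).
    by replace (INR r * (1 + INR lam / INR r)) with (INR r + INR lam) by (field; lra).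
  rewrite Rpow_mult_distr; apply: Rmult_le_compat_l; first by apply: pow_le; lra.
  rewrite -Rpower_pow; last exact: exp_pos.
  rewrite /Rpower ln_exp; apply: exp_le.
  apply: Rle_trans (_ : INR k ^ 2 / 2 * ((INR r ^ 2 / INR k + 1) / INR r) <= _).
    apply: Rmult_le_compat; [exact: pos_INR| |rewrite /= in HE *; lra|].
      by apply: Rmult_le_pos; [apply: pos_INR | apply/Rlt_le/Rinv_0_lt_compat].
    by apply: Rmult_le_compat_r lam_up; apply/Rlt_le/Rinv_0_lt_compat.
  by apply: Req_le; field; lra.
have HR : exp (INR r * INR k / 2 * (2 * l - ln (INR k))) <= INR lam ^ uphalf (r * k).
  rewrite -Rpower_pow; last exact: INR_gt0.
  apply: exp_le; apply: Rmult_le_compat => //; [nra | lra |].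
  have : (r * k <= 2 * uphalf (r * k))%N by move: (r * k)%N => a'; lia.
  by move/leq_INR; rewrite !INR_muln /=; lra.
set Q := INR r ^ E in HL *.
have Q0 : 0 < Q by apply: pow_lt.
apply: Rle_trans (Rmult_le_compat_r Q _ _ (Rlt_le _ _ Q0) HR).
apply: Rle_trans (Rmult_le_compat_r Q _ _ (Rlt_le _ _ Q0) (exp_le rateb)).
rewrite 3!exp_plus.
have N0 := pos_INR n; have M0 := pos_INR m.+1; have C0 := pos_INR 'C(m, k).
have MC := Rmult_le_compat _ _ _ _ M0 C0 HM HC.
have NMC := Rmult_le_compat _ _ _ _ N0 (Rmult_le_pos _ _ M0 C0) Hn MC.
have L0 : 0 <= (INR r + INR lam) ^ E by apply: pow_le; have := pos_INR lam; lra.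
have := Rmult_le_compat _ _ _ _ (Rmult_le_pos _ _ N0 (Rmult_le_pos _ _ M0 C0)) L0 NMC HL.
by lra.
Qed.

Theorem theorem1p3 :
  (* (i) *)
  (forall C : R, exp 2 < C ->
     exists r0 : nat, forall r : nat, (r0 <= r)%N ->
       (g (flr (Rpower (INR r) (log2 C / 2)))
          (flr (Rpower (INR r) (INR r / (2 * C)))) <= r)%N) /\
  (* (ii) *)
  (forall eps : R, 0 < eps ->
     exists r0 : nat, forall r : nat, (r0 <= r)%N ->
       (g (flr (Rpower 2 (eps * (log2 (INR r)) ^ 2)))
          (flr (Rpower 2 (Rpower (INR r) (1 - eps)))) <= r)%N) /\
  (* (iii) *)
  (exists c : R, 0 < c /\
     exists r0 : nat, forall r : nat, (r0 <= r)%N ->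
       (g (flr (c * INR r ^ 2))
          (flr (Rpower (INR r) (INR r ^ 2 / 2) / exp (INR r ^ 2))) <= r)%N).
Proof. by split; [exact: g_le_polynomial | split; [exact: g_le_quasipolynomial | exact: g_le_quadratic]]. Qed.
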